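(* Let $D$ be a positive digraph with at least one edge, with $q$ edges and $n$ vertices, and let $b$ be the number of connected components of $G_D$ that are bipartite. Then $\mathcal{P}_D$ is an integral polytope of dimension $q-2n+b$. The $d$-dimensional faces of $\mathcal{P}_D$ are exactly the $d$-dimensional polytopes $\mathcal{P}_{D'}$ of magic labelings of positive subdigraphs $D'$ of $D$ with all $n$ vertices of $D$ and at most $2n-b+d$ edges.
   Context: Digraphs may have loops. A magic labeling of magic sum $r$ of a digraph $D$ is an assignment of nonnegative integers to edges such that, at each vertex $v$, the labels of edges with initial vertex $v$ sum to $r$ and the labels of edges with terminal vertex $v$ sum to $r$ (a loop at $v$ counts in both sums). $\mathcal{P}_D\subseteq\mathbb{R}^q$ is the set of assignments of nonnegative reals to the edges such that at each vertex both the outgoing sum and incoming sum equal $1$. For a subdigraph $D'$ on the same vertices, $\mathcal{P}_{D'}$ is viewed inside $\mathcal{P}_D$ by setting labels of missing edges to $0$. For $D$ with vertices $v_1,\dots,v_n$, $G_D$ is the bipartite graph on $\{a_1,\dots,a_n\}\cup\{b_1,\dots,b_n\}$ with an edge $a_ib_j$ iff $D$ has an edge from $v_i$ to $v_j$. A graph $G$ is positive if for every edge $e$ there is a magic labeling of $G$ (nonnegative integer edge labels with all vertex sums of incident edge labels equal) giving $e$ a positive label; a digraph $D$ is positive if $G_D$ is positive. An integral polytope is one whose vertices have integer coordinates. *)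

(* Defs.v *)
From HB Require Import structures.
From mathcomp Require Import all_boot all_order all_algebra.
From mathcomp Require Import boolp classical_sets reals.
Set Implicit Arguments.
Unset Strict Implicit.
Unset Printing Implicit Defensive.
Import Order.TTheory GRing.Theory Num.Theory.
Local Open Scope ring_scope.

(* A graph on the finite type T is given by its set of edges; an edge joining
   u and v is the set [set u; v], so a loop at v is the singleton [set v]. *)
Definition graph (T : finType) := {set {set T}}.

(* Values of L outside of G are irrelevant. *)
Definition magic_labeling (T : finType) (G : graph T) (L : {set T} -> nat)
    (r : nat) : Prop :=
  forall v : T, (\sum_(e in G | v \in e) L e)%N = r.

Definition positive_graph (T : finType) (G : graph T) : Prop :=
  forall e, e \in G -> exists L r, magic_labeling G L r /\ (0 < L e)%N.

Definition adj (T : finType) (G : graph T) : rel T :=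
  fun u v => ([set u; v]%SET \in G).

Definition components (T : finType) (G : graph T) : {set {set T}} :=
  equivalence_partition (connect (adj G)) [set: T].

Definition bipartite_on (T : finType) (G : graph T) (C : {set T}) : bool :=
  [exists A : {set T},
    [forall u in C, forall v in C, adj G u v ==> ((u \in A) != (v \in A))]].

Definition nb_bipartite_components (T : finType) (G : graph T) : nat :=
  #|[set C in components G | bipartite_on G C]|.

(* A digraph on the vertices 0, ..., n-1 is its set of directed edges: (i, j)
   is the edge from i to j, and (i, i) a loop. *)
Definition digraph (n : nat) := {set 'I_n * 'I_n}.

(* The graph G_D, where a_i is inl i and b_j is inr j. *)
Definition bip_graph (n : nat) (D : digraph n) : graph ('I_n + 'I_n)%type :=
  [set [set inl ij.1; inr ij.2]%SET | ij in D].

Definition positive_digraph (n : nat) (D : digraph n) : Prop :=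
  positive_graph (bip_graph D).

Local Open Scope classical_set_scope.

(* R^o is R seen as a vector space over itself, so that R^I is a vectType. *)
Notation "'space' R I" := {ffun I%type -> R^o}
  (at level 10, R at level 8, I at level 8, only parsing).

Section Polytopes.
Variables (R : realType) (I : finType).
Implicit Types S P F : set (space R I).

Definition affine_hull S : set (space R I) :=
  [set x | exists (k : nat) (a : 'I_k -> R) (p : 'I_k -> space R I),
     [/\ forall i, S (p i), \sum_i a i = 1 & x = \sum_i a i *: p i]].

Definition convex_hull S : set (space R I) :=
  [set x | exists (k : nat) (a : 'I_k -> R) (p : 'I_k -> space R I),
     [/\ forall i, S (p i), forall i, 0 <= a i, \sum_i a i = 1
       & x = \sum_i a i *: p i]].

(* The dimension of the affine hull; the empty set has dimension -1. *)
Definition has_dim S (d : int) : Prop :=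
  (S = set0 /\ d = -1) \/
  (exists (p : space R I) (U : {vspace (space R I)}),
     affine_hull S = [set x | x - p \in U] /\ d = (\dim U)%:Z).

Definition is_polytope P : Prop :=
  exists s : seq (space R I), P = convex_hull [set` s].

(* Faces are cut out by the linear inequalities valid on P; P itself and the
   empty set are faces, given by 0 <= 0 and 0 <= 1. *)
Definition is_face P F : Prop :=
  exists (c : I -> R) (delta : R),
    (forall x, P x -> \sum_i c i * x i <= delta) /\
    F = [set x | P x /\ \sum_i c i * x i = delta].

Definition is_vertex P (x : space R I) : Prop := is_face P [set x].

Definition is_integral_polytope P : Prop :=
  is_polytope P /\
  forall x, is_vertex P x -> forall i, (x i : R) \is a Num.int.

End Polytopes.

Definition magic_polytope (R : realType) (n : nat) (D : digraph n) :
    set (space R {e in D}) :=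
  [set x | (forall e, 0 <= x e :> R) /\
     forall v : 'I_n, \sum_(e | (val e).1 == v) x e = 1 :> R /\
                      \sum_(e | (val e).2 == v) x e = 1 :> R].
Arguments magic_polytope R {n} D _.

(* A labeling of D', extended by 0 to the edges of D that D' lacks. *)
Definition extend0 (R : realType) (n : nat) (D D' : digraph n)
    (y : space R {e in D'}) : space R {e in D} :=
  [ffun e => oapp y 0 (insub (val e))].
Arguments extend0 {R n} D {D'} y.

Definition magic_polytope_in (R : realType) (n : nat) (D D' : digraph n) :
    set (space R {e in D}) :=
  extend0 D @` magic_polytope R D'.
Arguments magic_polytope_in R {n} D D' _.

(* Main.v *)
(* Orient each edge a_i b_j of G_D from a_i to b_j.  Then P_D is the set of
   nonnegative flows x whose boundary is 1 at every a_i and -1 at every b_j.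
   The boundary map has rank 2n - b, its image being the kernel of the map that
   sums a function over each component; a strictly positive flow, which exists
   because D is positive, lets P_D open up in all directions of the kernel, of
   dimension q - 2n + b.  Integrality is Birkhoff's theorem: the fractional
   edges of a flow have no vertex of degree one, hence carry a circulation,
   along which the flow moves in both directions until an edge vanishes.
   Finally, a nonempty face consists of all flows supported in the support of
   one of its points of maximal support, and by Birkhoff's theorem every edge of that
   support lies in a perfect matching inside the support. *)
Require Import Defs.
From HB Require Import structures.
From mathcomp Require Import all_boot all_order all_algebra.
From mathcomp Require Import boolp classical_sets reals.
From mathcomp Require Import zify.
Set Implicit Arguments.
Unset Strict Implicit.
Unset Printing Implicit Defensive.
Import Order.TTheory GRing.Theory Num.Theory.
Local Open Scope ring_scope.

(** * The boundary map of a directed multigraph *)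

Section Boundary.
Variables (F : fieldType) (V E : finType) (hd tl : E -> V).

Definition delta (I : finType) (i : I) : space F I := [ffun j => (j == i)%:R].

Lemma sum_delta (I : finType) (y : space F I) : y = \sum_i y i *: delta i.
Proof.
apply/ffunP => j; rewrite sum_ffunE (bigD1 j) //= !ffunE eqxx.
rewrite big1 ?addr0 => [|i]; first by rewrite /GRing.scale /= mulr1.
by rewrite eq_sym !ffunE => /negPf ->; rewrite scaler0.
Qed.

Definition boundary (x : space F E) : space F V :=
  \sum_e x e *: (delta (hd e) - delta (tl e)).

Fact boundary_is_linear : linear boundary.
Proof.
move=> a x y; rewrite /boundary scaler_sumr -big_split /=;
  apply: eq_bigr => e _.
by rewrite !ffunE scalerDl scalerA.
Qed.
HB.instance Definition _ :=
  GRing.isLinear.Build F (space F E) (space F V) _ boundary boundary_is_linear.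

Lemma boundaryE x v : boundary x v =
  \sum_(e | hd e == v) x e - \sum_(e | tl e == v) x e.
Proof.
rewrite sum_ffunE [in RHS]big_mkcond [X in _ - X]big_mkcond /= -sumrB.
apply: eq_bigr => e _; rewrite !ffunE !(eq_sym v) /GRing.scale /= mulrBr.
by do 2![case: (_ == v); rewrite ?mulr1 ?mulr0].
Qed.

(** An edge with both ends in [C] contributes its value once with each sign, and any other edge
    contributes nothing. *)
Lemma sum_boundary (C : {set V}) x :
  (forall e, (hd e \in C) = (tl e \in C)) -> \sum_(v in C) boundary x v = 0.
Proof.
move=> closedC; under eq_bigr do rewrite boundaryE.
rewrite sumrB; apply/eqP; rewrite subr_eq0; apply/eqP.
rewrite (exchange_big_dep xpredT) //= [RHS](exchange_big_dep xpredT) //=.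
have sum1 (u : V) e : \sum_(v in C | u == v) x e = if u \in C then x e else 0.
  case: ifP => uC; last first.
    by rewrite big1 // => v /andP[vC /eqP uv]; rewrite uv vC in uC.
  by rewrite (big_pred1 u) // => v /=; rewrite eq_sym; case: eqP => [->|];
    rewrite ?uC ?andbF.
by apply: eq_bigr => e _; rewrite !sum1 closedC.
Qed.

Lemma dim_space (I : finType) : \dim {: space F I} = #|I|.
Proof. by rewrite dimvf /dim /= muln1. Qed.

Variable r : rel V.
Hypothesis r_sym : symmetric r.
Hypothesis r_edge : forall e, r (hd e) (tl e).
Hypothesis edge_r : forall u v, r u v ->
  exists e, (hd e, tl e) = (u, v) \/ (hd e, tl e) = (v, u).
Let blocks := equivalence_partition (connect r) [set: V].

(** Telescoping along a path: each step of the path is, up to sign, the boundary of a single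
    edge. *)
Lemma delta_sub_limg u v : connect r u v ->
  delta u - delta v \in limg (linfun boundary).
Proof.
case/connectP => p + ->; elim: p u => [|w p IHp] u /=;
  first by rewrite subrr mem0v.
case/andP=> /edge_r[e he] /IHp pw.
rewrite -(subrK (delta w) (delta u)) -addrA; apply: rpredD => //.
have bd_e : delta (hd e) - delta (tl e) \in limg (linfun boundary).
  apply/memv_imgP; exists (delta e); rewrite ?memvf // lfunE /=.
  rewrite /boundary (bigD1 e) //= !ffunE eqxx scale1r big1 ?addr0 // => j.
  by rewrite ffunE => /negPf ->; rewrite scale0r.
by case: he => -[<- <-] //; rewrite -rpredN opprB.
Qed.

Definition block_sum (y : space F V) : space F {C in blocks} :=
  [ffun C : {C in blocks} => \sum_(v in val C) y v].

Fact block_sum_is_linear : linear block_sum.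
Proof.
move=> a x y; apply/ffunP => C; rewrite !ffunE scaler_sumr -big_split /=.
by apply: eq_bigr => v _; rewrite !ffunE.
Qed.
HB.instance Definition _ := GRing.isLinear.Build F (space F V)
  (space F {C in blocks}) _ block_sum block_sum_is_linear.

Let csym : connect_sym r. Proof. exact: sym_connect_sym. Qed.

Lemma mem_block u v C : C \in blocks -> u \in C -> (v \in C) = connect r u v.
Proof.
by case/imsetP=> w _ ->; rewrite !inE /= => /(same_connect csym) ->.
Qed.

(** Boundaries sum to 0 over each component. Conversely, if all component sums of [y] vanish, its
    mass can be carried along paths to the root of each component, where it cancels. *)
Lemma lker_block_sum : lker (linfun block_sum) = limg (linfun boundary).
Proof.
apply/eqP; rewrite eqEsubv; apply/andP; split; apply/subvP => y; last first.
  case/memv_imgP => x _ ->; rewrite memv_ker !lfunE /=; apply/eqP/ffunP => C.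
  rewrite [LHS]ffunE [RHS]ffunE; apply: sum_boundary => e.
  have /imsetP[w _ ->] := valP C.
  by rewrite !inE /= (same_connect_r csym (connect1 (r_edge e))).
rewrite memv_ker lfunE /= => /eqP y0.
(* The subtracted terms collect at each root the sum of [y] over its component, which is 0. *)
have -> : y = \sum_v y v *: (delta v - delta (fingraph.root r v)).
  under eq_bigr do rewrite scalerBr.
  rewrite sumrB -sum_delta [X in _ - X](_ : _ = 0) ?subr0 //.
  apply/ffunP => u; rewrite sum_ffunE ffunE.
  transitivity (\sum_(v | fingraph.root r v == u) y v).
    rewrite [RHS]big_mkcond; apply: eq_bigr => v _; rewrite !ffunE eq_sym.
    by case: ifP; rewrite /GRing.scale /= ?mulr1 ?mulr0.
  have uC : [set v in [set: V] | connect r u v] \in blocks by apply: imset_f.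
  have [ur|ur] := eqVneq (fingraph.root r u) u; last first.
    rewrite big1 // => v /eqP vu; case/eqP: ur.
    by rewrite -vu root_root.
  pose C : {C in blocks} := exist (fun C => C \in blocks) _ uC.
  have /ffunP/(_ C) := y0; rewrite !ffunE /= => {2}<-.
  by apply: eq_bigl => v; rewrite !inE /= -{1}ur root_connect // csym.
apply: rpred_sum => v _; apply: rpredZ; apply: delta_sub_limg.
exact: connect_root.
Qed.

(** Components are nonempty and disjoint, so the indicator of any vertex of [C] is sent to the
    indicator of [C]. *)
Lemma limg_block_sum : limg (linfun block_sum) = fullv.
Proof.
apply/eqP; rewrite eqEsubv subvf; apply/subvP => z _.
rewrite (sum_delta z); apply: rpred_sum => C _; apply: rpredZ.
have /imsetP[u _ Cu] := valP C.
have uC : u \in val C by rewrite Cu !inE connect0.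
apply/memv_imgP; exists (delta u); rewrite ?memvf // lfunE /=.
apply/ffunP => B; rewrite !ffunE.
have -> : (B == C) = (u \in val B).
  apply/eqP/idP => [-> //|uB]; apply/val_inj/setP => v.
  by rewrite (mem_block _ (valP B) uB) (mem_block _ (valP C) uC).
have [uB|uB] := boolP (u \in val B).
  rewrite (bigD1 u) //= ffunE eqxx big1 ?addr0 // => v /andP[_ /negPf].
  by rewrite ffunE => ->.
rewrite big1 // => v vB; rewrite ffunE; case: eqP => // vu.
by rewrite -vu vB in uB.
Qed.

Lemma dim_limg_boundary :
  (\dim (limg (linfun boundary)) + #|blocks| = #|V|)%N.
Proof.
have := limg_ker_dim (linfun block_sum) fullv.
by rewrite capfv lker_block_sum limg_block_sum !dim_space card_sig.
Qed.

Lemma dim_lker_boundary :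
  (\dim (lker (linfun boundary)) + #|V| = #|E| + #|blocks|)%N.
Proof.
have := limg_ker_dim (linfun boundary) fullv.
by rewrite capfv dim_space => <-; rewrite -addnA dim_limg_boundary.
Qed.

End Boundary.

(** * Convex hulls, dimension and faces *)

Section Hulls.
Variables (R : realType) (I : finType).
Implicit Types S : set (space R I).

Lemma scale_ffunE (a : R) (x : space R I) i : (a *: x) i = a * x i.
Proof. by rewrite ffunE. Qed.

Lemma convex_hull_sub S x : S x -> convex_hull S x.
Proof.
move=> Sx; exists 1%N, (fun=> 1), (fun=> x).
by split => //; rewrite big_ord1 ?scale1r.
Qed.

Lemma affine_hull_line S (a b : R) x y :
  S x -> S y -> a + b = 1 -> affine_hull S (a *: x + b *: y).
Proof.
move=> Sx Sy ab1.
exists 2%N, (fun i => if i == ord0 then a else b),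
  (fun i => if i == ord0 then x else y).
by split => [i||]; rewrite ?big_ord_recl ?big_ord0 /= ?addr0 //; case: ifP.
Qed.

Lemma convex_hull_segment S (a b : R) x y :
  convex_hull S x -> convex_hull S y -> 0 <= a -> 0 <= b -> a + b = 1 ->
  convex_hull S (a *: x + b *: y).
Proof.
move=> [k [c [p [Sp c0 c1 ->]]]] [l [d [q [Sq d0 d1 ->]]]] a0 b0 ab1.
exists (k + l)%N,
  (fun i => match split i with inl j => a * c j | inr j => b * d j end),
  (fun i => match split i with inl j => p j | inr j => q j end).
have splitl (j : 'I_k) : split (lshift l j) = inl j.
  by rewrite -[lshift l j]/(unsplit (inl j)) unsplitK.
have splitr (j : 'I_l) : split (rshift k j) = inr j.
  by rewrite -[rshift k j]/(unsplit (inr j)) unsplitK.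
split.
- by move=> i; case: split.
- by move=> i; case: split => j; apply: mulr_ge0.
- rewrite big_split_ord /=; under eq_bigr do rewrite splitl.
  under [X in _ + X]eq_bigr do rewrite splitr.
  by rewrite -!mulr_sumr c1 d1 !mulr1.
- rewrite big_split_ord /= !scaler_sumr; congr (_ + _); apply: eq_bigr => i _.
    by rewrite splitl scalerA.
  by rewrite splitr scalerA.
Qed.

(** The direction space of an affine subspace does not depend on the base point, and a coset is
    never empty, so the two cases of [has_dim] exclude each other. *)
Lemma has_dim_unique S d d' : has_dim S d -> has_dim S d' -> d = d'.
Proof.
(* An affine combination of no points is excluded, since an empty sum of coefficients is not 1. *)
have hull0 : affine_hull (set0 : set (space R I)) = set0.
  apply/seteqP; split => // x [[|k] [a [p [Sp a1 _]]]]; last by have := Sp ord0.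
  by move: a1; rewrite big_ord0 => /eqP; rewrite eq_sym oner_eq0.
have incl p (U : {vspace space R I}) p' (U' : {vspace space R I}) :
    [set x | x - p \in U]%classic = [set x | x - p' \in U']%classic ->
    (U <= U')%VS.
  move=> /seteqP[sub _]; apply/subvP => u Uu.
  have pU' : p - p' \in U' by apply: (sub p); rewrite /= subrr mem0v.
  have : p + u - p' \in U' by apply: (sub (p + u));
    rewrite /= addrAC subrr add0r.
  by rewrite addrAC => /(rpredB)/(_ pU'); rewrite [_ + u]addrC addrK.
move=> [[-> ->]|[p [U [SU ->]]]] [[S0 ->]|[p' [U' [SU' ->]]]] //.
- move: SU'; rewrite hull0 => /seteqP[_ /(_ p')].
  by rewrite /= subrr mem0v => /(_ isT).
- move: SU; rewrite S0 hull0 => /seteqP[_ /(_ p)].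
  by rewrite /= subrr mem0v => /(_ isT).
- have eqU : U = U'.
    apply/eqP; rewrite eqEsubv.
    by rewrite (incl p U p' U') -?SU // (incl p' U' p U) -?SU.
  by rewrite eqU.
Qed.

(* A point whose support has maximal size: midpoints merge supports. *)
Lemma max_support S :
  (forall x i, S x -> 0 <= x i) ->
  (forall x y, S x -> S y -> S (2^-1 *: x + 2^-1 *: y)) ->
  (exists x, S x) ->
  exists2 x, S x & forall y i, S y -> 0 < y i -> 0 < x i.
Proof.
move=> S_ge0 S_mid [x0 Sx0].
pose supp (x : space R I) := [set i | 0 < x i].
pose P k := `[< exists2 x, S x & #|supp x| = k >].
have exP : exists k, P k by exists #|supp x0|; apply/asboolP; exists x0.
have leP k : P k -> (k <= #|I|)%N.
  by move=> /asboolP[x _ <-]; apply: max_card.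
case: (ex_maxnP exP leP) => k /asboolP[x Sx <-] kmax.
exists x => // y i Sy yi.
pose z := 2^-1 *: x + 2^-1 *: y.
have half_gt0 : 0 < 2^-1 :> R by rewrite invr_gt0.
have zE j : z j = 2^-1 * (x j + y j) by rewrite !ffunE mulrDr.
have z_gt0 j : 0 < x j + y j -> 0 < z j by move=> ?; rewrite zE mulr_gt0.
have subz : supp x \subset supp z.
  apply/fintype.subsetP => j; rewrite !inE => xj.
  by apply/z_gt0/(lt_le_trans xj); rewrite lerDl S_ge0.
have /eqP eqxz : supp x == supp z.
  by rewrite eqEcard subz kmax //; apply/asboolP; exists z => //; exact: S_mid.
have : i \in supp z.
  by rewrite inE; apply/z_gt0/(lt_le_trans yi); rewrite lerDr S_ge0.
by rewrite -eqxz inE.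
Qed.

(* The time [t] is the least of the ratios [x i / - z i] over [z i < 0]. *)
Lemma exit_time (x z : space R I) :
  (forall i, 0 <= x i) -> (forall i, z i != 0 -> 0 < x i) ->
  (exists i, z i < 0) ->
  exists2 t, 0 < t & (forall i, 0 <= (x + t *: z) i) /\
    (exists2 i, 0 < x i & (x + t *: z) i = 0).
Proof.
move=> x0 xz [i0 zi0]; pose ratio i : R := x i / - z i.
case: (@arg_minP _ _ _ i0 (fun i => z i < 0) ratio zi0) => i zi imin.
have xi : 0 < x i by apply: xz; rewrite lt_eqF.
exists (ratio i); first by rewrite divr_gt0 // oppr_gt0.
split; last first.
  exists i => //; rewrite !ffunE /GRing.scale /= /ratio invrN mulrN mulNr.
  by rewrite divfK ?subrr // lt_eqF.
move=> j; rewrite !ffunE /GRing.scale /=.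
have [zj|zj] := ltP (z j) 0; last first.
  by rewrite addr_ge0 // mulr_ge0 // divr_ge0 // ltW // oppr_gt0.
have := imin j zj; rewrite /ratio ler_pdivlMr ?oppr_gt0 // mulrN => h.
by rewrite -(opprK (_ * _)) subr_ge0.
Qed.

(** If [z] has no negative coordinate, any step is allowed; otherwise stop at the exit time. *)
Lemma positive_step (x z : space R I) :
  (forall i, 0 <= x i) -> (forall i, z i != 0 -> 0 < x i) ->
  exists2 t, 0 < t & forall i, 0 <= (x + t *: z) i.
Proof.
move=> x0 xz; have [zneg|znneg] := pselect (exists i, z i < 0).
  by have [t t0 [? _]] := exit_time x0 xz zneg; exists t.
exists 1 => // i; rewrite !ffunE scale1r addr_ge0 // leNgt.
by apply/negP => zi; apply: znneg; exists i.
Qed.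

End Hulls.

(** Linear maps commute with affine hulls, and an injective one preserves the dimension of the
    direction space. *)
Lemma has_dim_image (R : realType) (I J : finType)
    (f : {linear space R I -> space R J}) (S : set (space R I)) d :
  injective f -> has_dim S d -> has_dim (f @` S)%classic d.
Proof.
move=> f_inj [[-> ->]|[p [U [SU ->]]]]; first by left; rewrite image_set0.
right; exists (f p), (linfun f @: U)%VS; split; last first.
  rewrite limg_dim_eq //; apply/eqP; rewrite -subv0.
  suff /eqP -> : lker (linfun f) == 0%VS by rewrite capv0.
  by apply/lker0P => x y; rewrite !lfunE => /f_inj.
have -> : affine_hull (f @` S)%classic = (f @` affine_hull S)%classic.
  apply/seteqP; split => y /=.
    case=> k [a [q [fSq a1 ->]]].
    have /choice[r Sr] i : exists x, S x /\ f x = q i.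
      by have [x Sx <-] := fSq i; exists x.
    exists (\sum_i a i *: r i); first by exists k, a, r; split => // i;
      have [] := Sr i.
    rewrite linear_sum; apply: eq_bigr => i _.
    by rewrite linearZ; have [_ ->] := Sr i.
  case=> x [k [a [r [Sr a1 ->]]]] <-; exists k, a, (f \o r); split => //.
    by move=> i; exists (r i).
  by rewrite linear_sum; apply: eq_bigr => i _; rewrite linearZ.
apply/seteqP; split => y /=.
  case=> x; rewrite SU /= => xpU <-.
  by apply/memv_imgP; exists (x - p) => //; rewrite lfunE /= linearB.
case/memv_imgP => u uU; rewrite lfunE /= => yE.
exists (u + p); first by rewrite SU /= addrK.
by rewrite linearD -yE subrK.
Qed.

Lemma half_add_half (R : numFieldType) : 2^-1 + 2^-1 = 1 :> R.
Proof. by rewrite [RHS](splitr 1) div1r. Qed.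

(** * Polyhedra of nonnegative flows with prescribed boundary *)

Section Polyhedron.
Variables (R : realType) (V E : finType) (hd tl : E -> V) (g : space R V).
Local Notation bd := (@boundary R V E hd tl).

Definition flows : set (space R E) :=
  [set x : space R E | (forall e, 0 <= x e) /\ bd x = g]%classic.

Lemma flows_mid x y : flows x -> flows y -> flows (2^-1 *: x + 2^-1 *: y).
Proof.
move=> [x0 xg] [y0 yg]; split=> [e|]; last first.
  by rewrite linearD !linearZ /= xg yg -scalerDl half_add_half scale1r.
by rewrite !ffunE addr_ge0 // mulr_ge0 // invr_ge0 ler0n.
Qed.

Lemma convex_hull_flows S x :
  (S `<=` flows)%classic -> convex_hull S x -> flows x.
Proof.
move=> Sflows [k [a [p [Sp a0 a1 ->]]]]; split=> [e|].
  rewrite sum_ffunE sumr_ge0 // => i _; rewrite scale_ffunE mulr_ge0 //.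
  by have [] := Sflows _ (Sp i).
rewrite linear_sum (eq_bigr (fun i => a i *: g)) => [|i _].
  by rewrite -scaler_suml a1 scale1r.
by rewrite linearZ; have [_ /= ->] := Sflows _ (Sp i).
Qed.

(** From a strictly positive flow one can move a little in every direction of the kernel, so the
    affine hull is the whole coset of the kernel through [x]. *)
Lemma has_dim_flows x : flows x -> (forall e, 0 < x e) ->
  has_dim flows (\dim (lker (linfun bd)))%:Z.
Proof.
move=> flx x_gt0; have [x_ge0 xg] := flx.
right; exists x, (lker (linfun bd)); split => //.
apply/seteqP; split => y /=.
  case=> k [a [p [flp a1 ->]]]; rewrite memv_ker lfunE /= linearB /= xg.
  rewrite linear_sum (eq_bigr (fun i => a i *: g)) => [|i _].
    by rewrite -scaler_suml a1 scale1r subrr.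
  by rewrite linearZ; have [_ /= ->] := flp i.
rewrite memv_ker lfunE /= => /eqP yx.
have [t t0 t_ge0] := @positive_step _ _ x (y - x) x_ge0 (fun e _ => x_gt0 e).
(* The point [y] need not be a flow, but it lies on the line through two flows; the first
   coefficient may be negative. *)
have -> : y = (1 - t^-1) *: x + t^-1 *: (x + t *: (y - x)).
  rewrite scalerDr addrA -scalerDl subrK scale1r scalerA mulVf ?gt_eqF //.
  by rewrite scale1r addrC subrK.
apply: affine_hull_line => //; last by rewrite subrK.
by split=> //; rewrite linearD linearZ /= yx scaler0 addr0.
Qed.

(** [T] is the support of a point [x] of [F] of maximal support. Given a flow [y] supported in [T],
    the segment from [y] to [x] can be prolonged beyond [x] inside the polyhedron; the functional is
    maximal at the inner point [x], hence also at [y]. *)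
Lemma face_flows F : is_face flows F -> (exists x, F x) ->
  exists T : {set E},
    (forall e, e \in T -> exists2 x, F x & 0 < x e) /\
    F = [set x | flows x /\ forall e, e \notin T -> x e = 0]%classic.
Proof.
move=> [c [dlt [cdlt Fc]]] neF.
have cD (a b : R) (x y : space R E) : \sum_e c e * (a *: x + b *: y) e =
    a * (\sum_e c e * x e) + b * (\sum_e c e * y e).
  rewrite !mulr_sumr -big_split; apply: eq_bigr => e _.
  by rewrite !ffunE /GRing.scale /= mulrDr !(mulrCA (c e)).
have F_mid x y : F x -> F y -> F (2^-1 *: x + 2^-1 *: y).
  rewrite Fc => -[flx cx] [fly cy]; split; first exact: flows_mid.
  by rewrite cD cx cy -mulrDl half_add_half mul1r.
have F_ge0 x e : F x -> 0 <= x e by rewrite Fc => -[[]].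
have [x Fx xmax] := max_support F_ge0 F_mid neF.
have [flx cx] : flows x /\ \sum_e c e * x e = dlt by rewrite Fc in Fx.
exists [set e | 0 < x e]; split; first by move=> e; rewrite inE; exists x.
apply/seteqP; split => y /=.
  move=> Fy; split=> [|e]; first by move: Fy; rewrite Fc => -[].
  rewrite inE => xe; apply/eqP; rewrite eq_le F_ge0 // andbT leNgt.
  by apply: contra xe; exact: xmax.
move=> [fly ysupp]; rewrite Fc; split=> //.
apply/eqP; rewrite eq_le cdlt //=.
have [t t0 t_ge0] : exists2 t, 0 < t & forall e, 0 <= (x + t *: (x - y)) e.
  apply: positive_step => [e|e]; first by have [] := flx.
  apply: contraNT => xe; have := F_ge0 x e Fx; rewrite le_eqVlt (negPf xe) orbF.
  by rewrite !ffunE ysupp ?inE // subr0 eq_sym.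
have : flows (x + t *: (x - y)).
  split=> //; have [_ xg] := flx; have [_ yg] := fly.
  by rewrite linearD linearZ linearB /= xg yg subrr scaler0 addr0.
have -> : x + t *: (x - y) = (1 + t) *: x + - t *: y.
  by rewrite scalerBr addrA scalerDl scale1r scaleNr.
move/cdlt; rewrite cD cx mulrDl mul1r mulNr -addrA gerDl subr_le0.
by rewrite ler_pM2l.
Qed.

End Polyhedron.

(** * Birkhoff's theorem *)

Lemma underdetermined (F : fieldType) (I J : finType)
    (f : space F I -> space F J) :
  linear f -> (#|J| < #|I|)%N -> exists2 z, z != 0 & f z = 0.
Proof.
move=> f_lin ltJI.
pose g : {linear space F I -> space F J} :=
  HB.pack f (GRing.isLinear.Build F (space F I) (space F J) _ f f_lin).
have := limg_ker_dim (linfun g) fullv; rewrite capfv !dim_space => dimE.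
have : lker (linfun g) != 0%VS.
  rewrite -dimv_eq0; apply: contraTneq ltJI => ker0.
  by rewrite -leqNgt -dimE ker0 add0n -(dim_space F J) dimvS ?subvf.
rewrite -vpick0 => nz; exists (vpick (lker (linfun g))) => //.
by apply/eqP; have := memv_pick (lker (linfun g)); rewrite memv_ker lfunE.
Qed.

(* A solution vanishing off T and with zero boundary at all vertices touched by
   T but one: if no degree is 1, these are fewer conditions than edges.  The
   boundary at the last vertex vanishes too, as boundaries sum to 0. *)
Lemma exists_circulation (F : fieldType) (V E : finType) (hd tl : E -> V)
    (T : {set E}) :
  T != finset.set0 ->
  (forall v,
    #|[set e in T | hd e == v]| + #|[set e in T | tl e == v]| != 1)%N ->
  exists z : space F E,
    [/\ z != 0, forall e, e \notin T -> z e = 0 & boundary hd tl z = 0].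
Proof.
case/set0Pn => e0 e0T deg_neq1.
pose deg v := (#|[set e in T | hd e == v]| + #|[set e in T | tl e == v]|)%N.
pose X := [set v | deg v != 0].
have sum_deg : (\sum_v deg v = 2 * #|T|)%N.
  have sum1 (h : E -> V) : (\sum_v #|[set e in T | h e == v]| = #|T|)%N.
    rewrite -[RHS]sum1_card (partition_big h xpredT) //=.
    by apply: eq_bigr => v _; rewrite -sum1_card; apply: eq_bigl => e;
      rewrite !inE.
  by rewrite big_split /= !sum1 mul2n addnn.
(* Every vertex of [X] has degree at least 2, and the degrees sum to twice the number of edges. *)
have leXT : (#|X| <= #|T|)%N.
  rewrite -(leq_pmul2l (isT : 0 < 2)%N) -sum_deg mulnC -sum_nat_const.
  rewrite [leqRHS](bigID (mem X)) /=; apply: leq_trans (leq_addr _ _).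
  apply: leq_sum => v; rewrite inE.
  by have := deg_neq1 v; rewrite -/(deg v); case: (deg v) => [|[]].
pose v0 := hd e0.
have v0X : v0 \in X.
  by rewrite inE addn_eq0 negb_and cards_eq0; apply/orP; left; apply/set0Pn;
     exists e0; rewrite !inE e0T eqxx.
(* One equation for each edge outside [T] and one for each vertex of [X] other than [v0]: dropping
   [v0] makes the count strictly smaller than the number of edges. *)
pose J : finType := ({e | e \notin T} + {v | v \in X :\ v0})%type.
pose f (z : space F E) : space F J := [ffun j => match j with
  | inl e => z (val e) | inr v => boundary hd tl z (val v) end].
have f_lin : linear f.
  by move=> a x y; apply/ffunP => -[e|v]; rewrite !ffunE //= linearP !ffunE.
have ltJE : (#|J| < #|E|)%N.
  rewrite card_sum !card_sig -(cardC T) addnC ltn_add2r.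
  by apply: leq_trans leXT; rewrite (cardsD1 v0 X) v0X add1n ltnS leq_eqVlt;
    apply/orP; left; apply/eqP; apply: eq_card.
have [z z_neq0 fz0] := underdetermined f_lin ltJE.
have zT e : e \notin T -> z e = 0.
  move=> eT; have /ffunP/(_ (inl (exist (fun e => e \notin T) e eT))) := fz0.
  by rewrite !ffunE.
exists z; split => //.
have bd_neq0 v : v != v0 -> boundary hd tl z v = 0.
  move=> vv0; have [vX|] := boolP (v \in X).
    have vJ : v \in X :\ v0 by rewrite in_setD1 vv0.
    have /ffunP/(_ (inr (exist (fun v => v \in X :\ v0) v vJ))) := fz0.
    by rewrite !ffunE.
  rewrite inE negbK addn_eq0 !cards_eq0 => /andP[/eqP hd0 /eqP tl0].
  rewrite boundaryE !big1 ?subrr // => e ev; apply: zT; apply/negP => eT.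
    by have := finset.in_set0 e; rewrite -tl0 inE eT ev.
  by have := finset.in_set0 e; rewrite -hd0 inE eT ev.
apply/ffunP => v; rewrite ffunE; have [->|/bd_neq0 //] := eqVneq v v0.
have : \sum_(v in [set: V]) boundary hd tl z v = 0.
  by apply: sum_boundary => e; rewrite !inE.
by rewrite (bigD1 v0) ?inE //= big1 ?addr0 // => u /andP[_ /bd_neq0].
Qed.

Section Birkhoff.
Variables (R : realType) (n : nat) (E : finType) (s t : E -> 'I_n).

Definition out_vertex (e : E) : 'I_n + 'I_n := inl (s e).
Definition in_vertex (e : E) : 'I_n + 'I_n := inr (t e).
Definition unit_flow : space R ('I_n + 'I_n) :=
  [ffun v => if v is inl _ then 1 else - 1].
Local Notation bd := (@boundary R _ E out_vertex in_vertex).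
Local Notation stochastic := (flows out_vertex in_vertex unit_flow).

Lemma boundary_inl x i : bd x (inl i) = \sum_(e | s e == i) x e.
Proof. by rewrite boundaryE [X in _ - X]big_pred0 ?subr0. Qed.

Lemma boundary_inr x j : bd x (inr j) = - \sum_(e | t e == j) x e.
Proof. by rewrite boundaryE big_pred0 ?sub0r. Qed.

Lemma stochasticP x : stochastic x <->
  (forall e, 0 <= x e) /\
  forall i, \sum_(e | s e == i) x e = 1 /\ \sum_(e | t e == i) x e = 1.
Proof.
split=> -[x0 x1]; split=> //; first move=> i.
  split; first by rewrite -boundary_inl x1 ffunE.
  by apply: oppr_inj; rewrite -boundary_inr x1 ffunE.
apply/ffunP => -[i|i]; rewrite ffunE ?boundary_inl ?boundary_inr.
  by have [] := x1 i.
by have [_ ->] := x1 i.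
Qed.

Lemma stochastic_le1 x e : stochastic x -> x e <= 1.
Proof.
move=> /stochasticP[x0 x1]; have [<- _] := x1 (s e).
by rewrite (bigD1 e) //= lerDl sumr_ge0.
Qed.

(** All edges go from the [inl] copy to the [inr] copy, so the outgoing sums of a circulation
    vanish; a nonnegative one would be 0. *)
Lemma circulation_lt0 z : z != 0 -> bd z = 0 -> exists e, z e < 0.
Proof.
move=> nz z0; apply: contrapT => nneg.
have z_ge0 e : 0 <= z e.
  by rewrite leNgt; apply/negP => ze; apply: nneg; exists e.
have sum0 : \sum_e z e = 0.
  rewrite (partition_big s xpredT) //= big1 // => i _.
  by rewrite -boundary_inl z0 ffunE.
case/eqP: nz; apply/ffunP => e; rewrite [RHS]ffunE; apply/eqP.
by move/eqP: sum0; rewrite psumr_eq0 // => /allP/(_ e);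
  rewrite mem_index_enum => /(_ isT).
Qed.

(** If [e0] were the only fractional edge, any other positive edge would be at least 1 and push the
    sum above 1; with no such edge, [e0] itself would have value 1. *)
Lemma fractional_neq1 (x : space R E) (P : pred E) :
  (forall e, 0 <= x e) -> \sum_(e | P e) x e = 1 ->
  #|[set e in [set e | 0 < x e < 1] | P e]| != 1%N.
Proof.
move=> x0 x1; apply/negP => /cards1P[e0 T1].
have : e0 \in [set e in [set e | 0 < x e < 1] | P e] by rewrite T1 inE.
rewrite !inE => /andP[/andP[e0_gt0 e0_lt1] Pe0].
have rest_ge0 : 0 <= \sum_(e | P e && (e != e0)) x e by apply: sumr_ge0.
move: x1; rewrite (bigD1 e0) //= => x1.
have /eqP : \sum_(e | P e && (e != e0)) x e = 0.
  apply: big1 => e /andP[Pe ne]; apply/eqP; rewrite eq_le x0 andbT leNgt.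
  apply/negP => xe; have : e \notin [set e in [set e | 0 < x e < 1] | P e].
    by rewrite T1 inE.
  rewrite !inE xe Pe andbT /= -leNgt => xe_ge1.
  have : 1 < x e0 + x e by apply: le_lt_trans xe_ge1 _; rewrite ltrDr.
  rewrite ltNge -[leRHS]x1 lerD2l (bigD1 e) /=; last by rewrite Pe.
  by rewrite lerDl sumr_ge0.
by move=> /eqP rest0; move: x1; rewrite rest0 addr0 => e01;
  rewrite e01 ltxx in e0_lt1.
Qed.

Definition zero_one_flows : set (space R E) :=
  [set y | stochastic y /\ forall e, y e = 0 \/ y e = 1]%classic.

(** At the exit time some positive edge becomes 0, and no edge enters the support because [z]
    vanishes off the support of [x]. *)
Lemma move_to_boundary x z : stochastic x -> bd z = 0 -> z != 0 ->
  (forall e, z e != 0 -> 0 < x e) ->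
  exists2 u, 0 < u & stochastic (x + u *: z) /\
    (#|[set e | (0 < (x + u *: z) e)%R]| < #|[set e | (0 < x e)%R]|)%N.
Proof.
move=> [x0 x1] z0 nz xz.
have [u u0 [xu0 [i xi xui]]] := exit_time x0 xz (circulation_lt0 nz z0).
exists u => //; split; first by split=> //;
  rewrite linearD linearZ /= z0 scaler0 addr0.
apply/proper_card/fintype.properP; split.
  apply/fintype.subsetP => e; rewrite !inE => xue;
    have [ze|] := eqVneq (z e) 0; last exact: xz.
  by move: xue; rewrite !ffunE ze scaler0 addr0.
by exists i; rewrite inE // xui ltxx.
Qed.

(** Induction on the size of the support. A circulation on the fractional edges writes [x] as a
    convex combination of two flows of smaller support. *)
Lemma birkhoff x : stochastic x -> convex_hull zero_one_flows x.
Proof.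
have [k] := ubnP #|[set e | 0 < x e]|; elim: k x => // k IHk x ltk stx.
have [x0 xsum] := (stochasticP x).1 stx.
pose T := [set e | 0 < x e < 1].
have [T0|T_neq0] := eqVneq T finset.set0.
  apply: convex_hull_sub; split=> // e.
  have : e \notin T by rewrite T0 inE.
  rewrite inE negb_and -!leNgt => /orP[xe|xe]; [left|right];
    by apply/eqP; rewrite eq_le xe ?x0 ?stochastic_le1.
have [v|z [nz zT z0]] :=
  @exists_circulation R _ _ out_vertex in_vertex T T_neq0.
  case: v => i; have [si ti] := xsum i.
    rewrite [X in (_ + X)%N](_ : _ = 0%N) ?addn0;
      first exact: fractional_neq1 si.
    by apply: eq_card0 => e; rewrite inE andbF.
  rewrite [X in (X + _)%N](_ : _ = 0%N) ?add0n; first exact: fractional_neq1 ti.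
  by apply: eq_card0 => e; rewrite inE andbF.
have xz e : z e != 0 -> 0 < x e.
  by move=> ze; have : e \in T; [apply:
    contraNT ze => /zT ->|rewrite inE => /andP[]].
have [u u0 [stu ltu]] := move_to_boundary stx z0 nz xz.
have [||e|w w0 [stw ltw]] := @move_to_boundary x (- z) stx.
- by rewrite linearN /= z0 oppr0.
- by rewrite oppr_eq0.
- by rewrite ffunE oppr_eq0; exact: xz.
have uw_gt0 : 0 < u + w by apply: addr_gt0.
(* The two exit points lie on opposite sides of [x], at times [u] and [w], whence the weights. *)
have -> : x = (w / (u + w)) *: (x + u *: z) + (u / (u + w)) *: (x + w *: - z).
  rewrite !scalerDr !scalerA scalerN addrACA -scalerDl -mulrDl (addrC w).
  by rewrite divff ?gt_eqF // scale1r mulrAC [w * u]mulrC mulrAC subrr addr0.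
apply: convex_hull_segment; rewrite ?divr_ge0 ?ltW //.
- by apply: IHk => //; apply: leq_trans ltu _.
- by apply: IHk => //; apply: leq_trans ltw _.
- by rewrite -mulrDl (addrC w) divff ?gt_eqF.
Qed.

Definition of_bool (f : {ffun E -> bool}) : space R E := [ffun e => (f e)%:R].

(** Finiteness comes from enumerating the boolean functions on the edges and keeping those that are
    flows. *)
Lemma zero_one_flowsP : exists l : seq (space R E), zero_one_flows =
  [set` l]%classic.
Proof.
exists [seq of_bool f | f <- enum {ffun E -> bool} &
  `[<stochastic (of_bool f)>]].
apply/seteqP; split => y /=.
  case=> sty y01; have yE : y = of_bool [ffun e => y e != 0].
    apply/ffunP => e; rewrite !ffunE.
    by case: (y01 e) => ->; rewrite ?eqxx ?oner_eq0.
  apply/mapP; exists [ffun e => y e != 0] => //.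
  by rewrite mem_filter mem_enum andbT; apply/asboolP; rewrite -yE.
case/mapP => f; rewrite mem_filter => /andP[/asboolP stf _] ->; split => // e.
by rewrite ffunE; case: (f e); [right|left].
Qed.

Lemma stochastic_hull : stochastic = convex_hull zero_one_flows.
Proof.
apply/seteqP; split => x; first exact: birkhoff.
by apply: convex_hull_flows => y [].
Qed.

(** Write [x] as a convex combination of points of [S]. The functional exposing [x] has nonnegative
    gaps at these points with weighted sum 0, so a point of nonzero weight attains the maximum and
    equals [x]. *)
Lemma hull_vertex (I : finType) (S : set (space R I)) x :
  is_vertex (convex_hull S) x -> S x.
Proof.
move=> [c [dlt [cdlt xF]]].
have [[k [a [p [Sp a0 a1 xE]]]] cx] :
    convex_hull S x /\ \sum_i c i * x i = dlt.
  by have : [set x]%classic x by []; rewrite xF.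
have [i ai] : exists i, a i != 0.
  apply: contrapT => na; move: a1; rewrite big1 => [/eqP|i _].
    by rewrite eq_sym oner_eq0.
  by apply: contrapT => /eqP ai; apply: na; exists i.
pose val (y : space R I) := \sum_i c i * y i.
have val_le j : 0 <= a j * (dlt - val (p j)).
  by rewrite mulr_ge0 // subr_ge0 cdlt //; apply: convex_hull_sub.
have : \sum_j a j * (dlt - val (p j)) = 0.
  under eq_bigr do rewrite mulrBr.
  rewrite sumrB -mulr_suml a1 mul1r -cx xE; apply/eqP; rewrite subr_eq0;
    apply/eqP.
  under [RHS]eq_bigr do rewrite mulr_sumr.
  rewrite exchange_big /=; apply: eq_bigr => j _.
  rewrite sum_ffunE mulr_sumr; apply: eq_bigr => l _.
  by rewrite scale_ffunE mulrCA.
move/eqP; rewrite psumr_eq0 // => /allP/(_ i);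
  rewrite mem_index_enum => /(_ isT).
rewrite /= mulf_eq0 (negPf ai) subr_eq0 => /eqP ci.
suff : [set x]%classic (p i) by move=> <-.
by rewrite xF; split=> //; apply: convex_hull_sub.
Qed.

Lemma stochastic_integral : is_integral_polytope stochastic.
Proof.
split; first by rewrite stochastic_hull; have [l ->] := zero_one_flowsP;
  exists l.
move=> x; rewrite stochastic_hull => /hull_vertex[_ x01] e.
by case: (x01 e) => ->; rewrite ?int_num0 ?int_num1.
Qed.

(** In a Birkhoff decomposition of [x], some term of nonzero weight is nonzero at [e]; since all
    terms are nonnegative, it vanishes wherever [x] does. *)
Lemma zero_one_flow_through x e : stochastic x -> 0 < x e ->
  exists2 y, zero_one_flows y & y e = 1 /\ forall e', x e' = 0 -> y e' = 0.
Proof.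
move=> /birkhoff[k [a [p [p01 a0 a1 xE]]]] xe.
have p_ge0 i e' : 0 <= a i * p i e' by have [[? _] _] := p01 i;
  rewrite mulr_ge0.
have xE' e' : x e' = \sum_i a i * p i e'.
  by rewrite xE sum_ffunE; apply: eq_bigr => i _; rewrite ffunE.
have [i ai] : exists i, a i * p i e != 0.
  apply: contrapT => na; move: xe; rewrite xE' big1 ?ltxx // => i _.
  by apply: contrapT => /eqP ai; apply: na; exists i.
move: ai; rewrite mulf_eq0 negb_or => /andP[ai pie].
exists (p i) => //; split.
  by have [_ /(_ e)[pe|//]] := p01 i; rewrite pe eqxx in pie.
move=> e'; rewrite xE' => /eqP; rewrite psumr_eq0 // => /allP/(_ i).
by rewrite mem_index_enum => /(_ isT); rewrite /= mulf_eq0 (negPf ai) => /eqP.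
Qed.

End Birkhoff.

(** * Magic polytopes of digraphs *)

Section BipartiteGraph.
Variable n : nat.
Implicit Types (D : digraph n) (p : 'I_n * 'I_n).

Definition bip_edge p : {set 'I_n + 'I_n} := [set inl p.1; inr p.2].

Lemma inl_bip_edge p i : (inl i \in bip_edge p) = (p.1 == i).
Proof. by rewrite !inE orbF eq_sym. Qed.

Lemma inr_bip_edge p j : (inr j \in bip_edge p) = (p.2 == j).
Proof. by rewrite !inE /= eq_sym. Qed.

Lemma bip_edge_inj : injective bip_edge.
Proof.
move=> [i j] p eqp.
have := inl_bip_edge p i; rewrite -eqp inl_bip_edge eqxx => /esym/eqP pi.
have := inr_bip_edge p j; rewrite -eqp inr_bip_edge eqxx => /esym/eqP pj.
by case: p {eqp} pi pj => /= ? ? -> ->.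
Qed.

Lemma bip_edge_eq u v p : [set u; v]%SET = bip_edge p ->
  (u, v) = (inl p.1, inr p.2) \/ (u, v) = (inr p.2, inl p.1).
Proof.
move=> eqp; have mem w : w \in bip_edge p -> (w == u) || (w == v).
  by rewrite -eqp !inE.
have eu : u \in bip_edge p by rewrite -eqp !inE eqxx.
have ev : v \in bip_edge p by rewrite -eqp !inE eqxx orbT.
case: u v eu ev {eqp} mem => i [] j; rewrite ?inl_bip_edge ?inr_bip_edge.
- by move=> _ _ /(_ (inr p.2)); rewrite inr_bip_edge eqxx => /(_ isT).
- by move=> /eqP <- /eqP <-; left.
- by move=> /eqP <- /eqP <-; right.
- by move=> _ _ /(_ (inl p.1)); rewrite inl_bip_edge eqxx => /(_ isT).
Qed.

Lemma adj_sym (T : finType) (G : graph T) : symmetric (adj G).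
Proof. by move=> u v; rewrite /adj finset.setUC. Qed.

Lemma bipartite_bip_graph D C : bipartite_on (bip_graph D) C.
Proof.
apply/existsP; exists [set inl i | i : 'I_n].
apply/forall_inP => u _; apply/forall_inP => v _; apply/implyP.
have inlA i : (inl i : 'I_n + 'I_n) \in [set inl i | i : 'I_n] by apply:
  imset_f.
have inrA i : (inr i : 'I_n + 'I_n) \in [set inl i | i : 'I_n] = false.
  by apply/negP => /imsetP[].
by case/imsetP => p _ /bip_edge_eq[] [-> ->]; rewrite inlA inrA.
Qed.

(** Every component is bipartite, with the [inl] copy as one side, so the number [b] of the theorem
    counts all components. *)
Lemma nb_bipartite_componentsE D :
  nb_bipartite_components (bip_graph D) = #|components (bip_graph D)|.
Proof.
by apply: eq_card => C; rewrite inE bipartite_bip_graph andbT.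
Qed.

End BipartiteGraph.

(** * The magic polytope as a polytope of flows *)

Section MagicPolytope.
Variables (R : realType) (n : nat).
Implicit Types D : digraph n.

Definition src D (e : {e in D}) : 'I_n := (val e).1.
Definition tgt D (e : {e in D}) : 'I_n := (val e).2.
Local Notation bd D :=
  (@boundary R _ {e in D} (out_vertex (@src D)) (in_vertex (@tgt D))).

Lemma magic_polytopeE D : magic_polytope R D =
  flows (out_vertex (@src D)) (in_vertex (@tgt D)) (unit_flow R n).
Proof. by apply/seteqP; split => x /stochasticP. Qed.

Lemma card_edges D : #|{: {e in D}}| = #|D|.
Proof. by rewrite card_sig; apply: eq_card. Qed.

Lemma dim_lker_boundary_digraph D :
  (\dim (lker (linfun (bd D))) + 2 * n =
   #|D| + nb_bipartite_components (bip_graph D))%N.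
Proof.
rewrite nb_bipartite_componentsE /components.
have := @dim_lker_boundary R _ _ (out_vertex (@src D)) (in_vertex (@tgt D))
  (adj (bip_graph D)) (@adj_sym _ _).
rewrite card_sum !card_ord card_edges addnn mul2n => dimE; apply: dimE.
  by move=> e; apply: imset_f (valP e).
move=> u v /imsetP[p pD /bip_edge_eq uv].
exists (exist (fun p => p \in D) p pD).
by case: uv => -[-> ->]; [left|right].
Qed.

Lemma dim_limg_boundary_digraph D :
  (\dim (limg (linfun (bd D))) + nb_bipartite_components (bip_graph D) =
    2 * n)%N.
Proof.
have := limg_ker_dim (linfun (bd D)) fullv.
have := dim_lker_boundary_digraph D.
rewrite capfv dim_space card_edges => h1 h2.
by apply/eqP; rewrite -(eqn_add2l (\dim (lker (linfun (bd D))))) h1 addnA h2.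
Qed.

(** A magic labeling of sum [r] becomes a point of the polytope after division by [r]. Conversely, a
    0-1 flow through an edge is a perfect matching, that is, a magic labeling of sum 1. *)
Lemma positive_digraphP D : positive_digraph D <->
  forall e : {e in D}, exists2 x, magic_polytope R D x & 0 < x e.
Proof.
have edgeG (e : {e in D}) : bip_edge (val e) \in bip_graph D.
  exact: imset_f (valP e).
split=> [Dpos e|Dpos].
  have [L [r [Lr Le]]] := Dpos _ (edgeG e).
  have sumL v : (\sum_(p : {e in D} | v \in bip_edge (val p))
      L (bip_edge (val p)) = r)%N.
    rewrite -(Lr v) [RHS]big_mkcondr big_imset /=;
      last by move=> p p' _ _ /bip_edge_inj.
    by rewrite [RHS]big_sub [LHS]big_mkcond; apply: eq_bigr => p _;
      rewrite /bip_edge.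
  have r_gt0 : (0 < r)%N.
    rewrite -(sumL (inl (val e).1)) (bigD1 e) /=; last by rewrite !inE eqxx.
    by rewrite addn_gt0 Le.
  exists [ffun p => (L (bip_edge (val p)))%:R / r%:R]; last first.
    by rewrite ffunE divr_gt0 ?ltr0n.
  split=> [p|i]; first by rewrite ffunE divr_ge0 ?ler0n.
  have sum1 v : \sum_(p : {e in D} | v \in bip_edge (val p))
      (L (bip_edge (val p)))%:R / r%:R = 1 :> R.
    by rewrite -mulr_suml -natr_sum sumL divff // pnatr_eq0 -lt0n.
  split; [rewrite -[RHS](sum1 (inl i))|rewrite -[RHS](sum1 (inr i))].
    by apply: eq_big => [p|p _]; rewrite ?inl_bip_edge ?ffunE.
  by apply: eq_big => [p|p _]; rewrite ?inr_bip_edge ?ffunE.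
move=> _ /imsetP[p pD ->]; pose e : {e in D} := exist (fun p => p \in D) p pD.
have [x + xe] := Dpos e; rewrite magic_polytopeE => stx.
have [y [sty y01] [ye _]] := zero_one_flow_through stx xe.
pose m (e : {e in D}) : nat := y e != 0.
have mE e' : (m e')%:R = y e' :> R.
  by rewrite /m; case: (y01 e') => ->; rewrite ?eqxx ?oner_eq0.
(* Labelings are functions on all sets of vertices; by injectivity of [bip_edge] this sum has at
   most one term, and it transports [m] to the edges of the graph. *)
exists (fun a => \sum_(e : {e in D} | bip_edge (val e) == a) m e)%N, 1%N; split.
  move=> v.
  transitivity (\sum_(e : {e in D} | v \in bip_edge (val e)) m e)%N.
    rewrite (partition_big (fun e : {e in D} => bip_edge (val e))
      (fun a => (a \in bip_graph D) && (v \in a))) /=; last first.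
      by move=> e' ve'; rewrite edgeG.
    apply: eq_bigr => a /andP[_ va]; apply: eq_bigl => e'.
    by case: eqP => [->|]; rewrite ?va ?andbF.
  apply: (can_inj (@natrK R)); rewrite natr_sum.
  under eq_bigr do rewrite mE.
  have [_ /(_ _)sum1] := (stochasticP _ _ _).1 sty.
  case: v => i; have [out1 in1] := sum1 i.
    by rewrite -[RHS]out1; apply: eq_bigl => e'; rewrite inl_bip_edge.
  by rewrite -[RHS]in1; apply: eq_bigl => e'; rewrite inr_bip_edge.
rewrite (bigD1 e) ?eqxx //=.
by rewrite /m ye oner_eq0.
Qed.

Lemma max_support_magic_polytope D : positive_digraph D -> D != finset.set0 ->
  exists2 x, magic_polytope R D x & forall e, 0 < x e.
Proof.
move=> /positive_digraphP Dpos /set0Pn[p0 p0D].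
pose e0 : {e in D} := exist (fun p => p \in D) p0 p0D.
have [|||x stx xmax] := @max_support _ _ (magic_polytope R D).
- by move=> x e [].
- by rewrite magic_polytopeE; exact: flows_mid.
- by have [x Px _] := Dpos e0; exists x.
by exists x => // e; have [y Py ye] := Dpos e; exact: xmax Py ye.
Qed.

Lemma has_dim_magic_polytope D : positive_digraph D -> D != finset.set0 ->
  has_dim (magic_polytope R D)
    (#|D|%:Z - (2 * n)%:Z + (nb_bipartite_components (bip_graph D))%:Z).
Proof.
move=> Dpos /(max_support_magic_polytope Dpos)[x].
rewrite magic_polytopeE => stx /(has_dim_flows stx); congr has_dim.
by apply/eqP; rewrite addrAC -PoszD -dim_lker_boundary_digraph PoszD addrK.
Qed.

(** The vertex [i] carries an empty sum that would have to be 1. Without any vertex the polytope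
    would be a single point. *)
Lemma magic_polytope_set0 (i : 'I_n) : magic_polytope R (finset.set0 :
  digraph n) = set0.
Proof.
apply/seteqP; split => // x [_ /(_ i)[+ _]].
rewrite big_pred0 => [/esym/eqP|[e e0]]; first by rewrite oner_eq0.
by exfalso; move: e0; rewrite finset.in_set0.
Qed.

(** * Extension by zero from a subdigraph *)

Section Extension.
Variables D D' : digraph n.
Hypothesis sub_D : D' \subset D.
Local Notation ext := (@extend0 R n D D').

Fact extend0_is_linear : linear ext.
Proof.
move=> a x y; apply/ffunP => e; rewrite !ffunE.
by case: insub => [e'|] /=; rewrite ?ffunE // scaler0 addr0.
Qed.
HB.instance Definition _ := GRing.isLinear.Build R (space R {e in D'})
  (space R {e in D}) _ ext extend0_is_linear.

Definition widen_edge (e : {e in D'}) : {e in D} :=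
  exist (fun p => p \in D) (val e) (fintype.subsetP sub_D _ (valP e)).

Lemma extend0_widen y e : ext y (widen_edge e) = y e.
Proof. by rewrite ffunE /= valK. Qed.

Lemma extend0_out y (e : {e in D}) : val e \notin D' -> ext y e = 0.
Proof. by move=> eD'; rewrite ffunE insubN. Qed.

Lemma extend0_inj : injective ext.
Proof. by move=> x y xy; apply/ffunP => e;
  rewrite -extend0_widen xy extend0_widen. Qed.

Lemma boundary_extend0 y : bd D (ext y) = bd D' y.
Proof.
pose b (p : 'I_n * 'I_n) : space R ('I_n + 'I_n) :=
  delta _ (inl p.1) - delta _ (inr p.2).
pose Y p : R^o := oapp y 0 (insub p).
transitivity (\sum_(p in D) Y p *: b p).
  by rewrite big_sub; apply: eq_bigr => e _; rewrite ffunE.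
rewrite (bigID (mem D')) /= [X in _ + X]big1 ?addr0; last first.
  by move=> p /andP[_ pD']; rewrite /Y insubN // scale0r.
transitivity (\sum_(p in D') Y p *: b p).
  apply: eq_bigl => p; rewrite andb_idl //; exact: fintype.subsetP.
by rewrite big_sub; apply: eq_bigr => e _; rewrite /Y valK.
Qed.

Lemma magic_polytope_inE : magic_polytope_in R D D' =
  [set x | magic_polytope R D x /\ forall e : {e in D},
    val e \notin D' -> x e = 0]%classic.
Proof.
apply/seteqP; split=> x /=.
  case=> y + <-; rewrite !magic_polytopeE => -[y0 y1].
  split; last exact: extend0_out.
  split; last by rewrite boundary_extend0.
  by move=> e; rewrite ffunE; case: insub => /=.
rewrite magic_polytopeE => -[[x0 x1] xD'].
pose y : space R {e in D'} := [ffun e => x (widen_edge e)].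
have yx : ext y = x.
  apply/ffunP => e; have [eD'|eD'] := boolP (val e \in D'); last first.
    by rewrite extend0_out ?xD'.
  rewrite ffunE insubT /= ffunE; congr (x _); exact: val_inj.
exists y => //; rewrite magic_polytopeE; split; first by move=> e;
  rewrite ffunE.
by rewrite -boundary_extend0 yx.
Qed.

(** The face is exposed by minus the total label off [D'], whose maximum 0 is attained exactly when
    all these labels vanish. *)
Lemma is_face_magic_polytope_in :
  is_face (magic_polytope R D) (magic_polytope_in R D D').
Proof.
exists (fun e => - (val e \notin D')%:R), 0; rewrite magic_polytope_inE.
have term_le0 (x : space R {e in D}) e : magic_polytope R D x ->
    0 <= (val e \notin D')%:R * x e by case=> x0 _; rewrite mulr_ge0.
have sumE (x : space R {e in D}) : \sum_e - (val e \notin D')%:R * x e =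
    - \sum_e (val e \notin D')%:R * x e.
  by rewrite -sumrN; apply: eq_bigr => e _; rewrite mulNr.
split=> [x Px|]; first by rewrite sumE oppr_le0 sumr_ge0 // => e _;
  exact: term_le0.
apply/seteqP; split=> x /= [Px xD']; split=> //.
  rewrite sumE big1 ?oppr0 // => e _; case: (boolP (val e \in D')) => eD'.
    by rewrite mul0r.
  by rewrite xD' ?mulr0.
move=> e eD'; move/eqP: xD'; rewrite sumE oppr_eq0 psumr_eq0; last first.
  by move=> e' _; exact: term_le0.
by move/allP/(_ e); rewrite mem_index_enum eD' mul1r => /(_ isT)/eqP.
Qed.

(** Boundaries of labelings of [D'] are boundaries of labelings of [D], and each image has dimension
    2n minus the number of components. *)
Lemma nb_components_sub : (nb_bipartite_components (bip_graph D) <=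
  nb_bipartite_components (bip_graph D'))%N.
Proof.
have sub_limg : (limg (linfun (bd D')) <= limg (linfun (bd D)))%VS.
  apply/subvP => z /memv_imgP[y _ ->]; rewrite lfunE /= -boundary_extend0.
  by apply/memv_imgP; exists (ext y); rewrite ?memvf // lfunE.
rewrite -(leq_add2l (\dim (limg (linfun (bd D'))))) dim_limg_boundary_digraph.
by rewrite -[leqRHS](dim_limg_boundary_digraph D) leq_add2r dimvS.
Qed.

Lemma has_dim_magic_polytope_in d : has_dim (magic_polytope R D') d ->
  has_dim (magic_polytope_in R D D') d.
Proof. exact: has_dim_image extend0_inj. Qed.

End Extension.

End MagicPolytope.

Theorem theorem1p8 (R : realType) (n : nat) (D : digraph n) (q b : nat)
  (Dpos : positive_digraph D) (Dedge : D != finset.set0)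
  (hq : q = #|D|) (hb : b = nb_bipartite_components (bip_graph D)) :
  [/\ is_integral_polytope (magic_polytope R D),
      has_dim (magic_polytope R D) (q%:Z - (2 * n)%:Z + b%:Z)
    & forall (d : int) (F : set (space R {e in D})),
        (is_face (magic_polytope R D) F /\ has_dim F d) <->
        (exists D' : digraph n,
           [/\ D' \subset D, positive_digraph D',
               #|D'|%:Z <= (2 * n)%:Z - b%:Z + d,
               has_dim (magic_polytope R D') d
             & F = magic_polytope_in R D D'])].
Proof.
have /set0Pn[p0 _] := Dedge.
(* The boundary map is nonzero, since [unit_flow] is a value of it. The strict inequality gives the
   edge bound for the empty subdigraph, where the dimension is -1. *)
have two_n_gt : (b < 2 * n)%N.
  rewrite hb -(dim_limg_boundary_digraph R D) -[ltnLHS]add0n ltn_add2r lt0n.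
  rewrite dimv_eq0; apply/negP => /eqP limg0.
  have [x + _] := max_support_magic_polytope R Dpos Dedge.
  rewrite magic_polytopeE => -[_ bdx].
  have : unit_flow R n \in 0%VS.
    by rewrite -limg0 -bdx; apply/memv_imgP; exists x; rewrite ?memvf // lfunE.
  rewrite memv0 => /eqP/ffunP/(_ (inl p0.1)); rewrite !ffunE => /eqP.
  by rewrite oner_eq0.
(* For nonempty [D'] with b' components the dimension is |D'| - 2n + b', and b' is at least [b]:
   this is the bound on the number of edges. *)
have dimD' (D' : digraph n) : positive_digraph D' -> D' \subset D ->
    exists2 d, has_dim (magic_polytope R D') d & #|D'|%:Z <=
      (2 * n)%:Z - b%:Z + d.
  move=> D'pos sub_D; have [->|D'edge] := eqVneq D' finset.set0.
    exists (-1); first by left; rewrite (magic_polytope_set0 R p0.1).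
    by rewrite cards0; lia.
  exists (#|D'|%:Z - (2 * n)%:Z + (nb_bipartite_components (bip_graph D'))%:Z).
    exact: has_dim_magic_polytope.
  by have := nb_components_sub R sub_D; rewrite -hb; lia.
split.
- by rewrite magic_polytopeE; exact: stochastic_integral.
- by rewrite hq hb; exact: has_dim_magic_polytope.
move=> d F; split; last first.
  case=> D' [sub_D D'pos _ dimD -> ].
  by split; [exact: is_face_magic_polytope_in|exact: has_dim_magic_polytope_in].
case=> faceF dimF.
(* The dimension and the edge bound then follow, because the dimension of [F] is unique. *)
suff [D' [sub_D D'pos FE]] : exists D' : digraph n,
    [/\ D' \subset D, positive_digraph D' & F = magic_polytope_in R D D'].
  have [d' dim' le_d'] := dimD' D' D'pos sub_D.
  have dd' : d' = d.
    by apply: (has_dim_unique _ dimF); rewrite FE;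
      exact: has_dim_magic_polytope_in.
  by exists D'; rewrite -dd'.
(* The empty face comes from the empty subdigraph, which is vacuously positive. *)
have [neF|F0] := pselect (exists x, F x); last first.
  exists finset.set0; split.
  - exact: finset.sub0set.
  - by move=> e /imsetP[p]; rewrite finset.in_set0.
  - rewrite /magic_polytope_in (magic_polytope_set0 R p0.1) image_set0.
    by apply/seteqP; split => // x Fx; apply: F0; exists x.
rewrite magic_polytopeE in faceF.
have [T [posT FT]] := face_flows faceF neF.
have sub_D : [set val e | e in T] \subset D.
  by apply/fintype.subsetP => _ /imsetP[e _ ->]; exact: valP.
have FE : F = magic_polytope_in R D [set val e | e in T].
  rewrite magic_polytope_inE // magic_polytopeE FT.
  apply/seteqP; split=> x /= [flx xT]; split=> // e eT; apply: xT.
    by apply: contra eT => eT; exact: imset_f.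
  by rewrite mem_imset //; exact: val_inj.
exists [set val e | e in T]; split => //.
(* Each edge of [T] is positive at some point of [F], and that point is the extension of a point of
   the polytope of the subdigraph. *)
apply/(positive_digraphP R) => e.
have /imsetP[e' e'T ee'] := valP e.
have [x Fx xe'] := posT e' e'T.
move: Fx; rewrite FE => -[y Py yx]; exists y => //.
rewrite -(extend0_widen sub_D) yx (_ : widen_edge sub_D e = e') //.
exact: val_inj.
Qed.
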